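(* Let $m=p_1p_2\cdots p_s$ be a product of distinct primes, and let $G=(V,E)$ be a connected graph with vertices ordered $v_1,\dots,v_n$ and edge-labeling $\alpha:E\to\{\text{ideals of }\mathbb{Z}/m\mathbb{Z}\}$. Let $\mathbb{B}_m$ be the minimum generating set of $[\mathbb{Z}/m\mathbb{Z}]_{G,\alpha}$ constructed as in the context. Then for $\mathbf{b}^{(i)},\mathbf{b}^{(j)}\in\mathbb{B}_m$, \[\mathbf{b}^{(i)}\mathbf{b}^{(j)}=\begin{cases}\mathbf{0}&\text{if } i\neq j,\\ \mathbf{b}^{(i)}&\text{if } i=j,\end{cases}\] where multiplication of splines is entrywise.
   Context: For a commutative ring $R$, a finite connected graph $G$ and an edge-labeling $\alpha$ assigning to each edge an ideal of $R$, a spline is $\mathbf{f}\in R^{|V|}$ with $\mathbf{f}_u-\mathbf{f}_v\in\alpha(uv)$ for every edge $uv$; splines form a ring $R_{G,\alpha}$ under entrywise addition and multiplication. For each prime $p_r$, reduce the labels to ideals of $\mathbb{Z}/p_r\mathbb{Z}$; a zero-connected component is a class of vertices joined by paths of edges labeled by the zero ideal; $\mathbb{B}_{p_r}$ is the set of splines over $\mathbb{Z}/p_r\mathbb{Z}$ equal to $1$ on one zero-connected component and $0$ elsewhere (one for each component). Order each $\mathbb{B}_{p_r}$ (arbitrarily); $\mathbb{B}_m$ is obtained by, for $s'=1,2,\dots$, taking the $s'$-th element of each $\mathbb{B}_{p_r}$ (the zero spline if $\mathbb{B}_{p_r}$ is exhausted) and forming the unique spline over $\mathbb{Z}/m\mathbb{Z}$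 reducing modulo each $p_r$ to the chosen element (Chinese remainder theorem), until every element of every $\mathbb{B}_{p_r}$ has been used exactly once; the resulting splines are $\mathbf{b}^{(1)},\mathbf{b}^{(2)},\dots$. *)

(* Defs.v *)
From mathcomp Require Import all_boot all_order all_algebra.

Set Implicit Arguments.
Unset Strict Implicit.
Unset Printing Implicit Defensive.

Import GRing.Theory.
Local Open Scope ring_scope.

(* The edge set of a graph on V is a set of two-element subsets of V, and an
   edge labeling is only consulted on edges, where it is symmetric in the two
   endpoints by construction. *)
Section Splines.

Variables (V : finType) (R : finComNzRingType).

Definition simple_graph (E : {set {set V}}) : Prop :=
  forall e, e \in E -> #|e| = 2.

Definition adj (E : {set {set V}}) : rel V := fun u v => [set u; v] \in E.

Definition connected_graph (E : {set {set V}}) : Prop :=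
  (0 < #|V|)%N /\ forall u v, connect (adj E) u v.

(* The ideals of ring_quotient are proper; an edge may be labeled by the unit
   ideal, hence this definition. *)
Definition is_ideal (I : {set R}) : Prop :=
  zmod_closed I /\ forall a x, x \in I -> a * x \in I.

Definition edge_labeling (E : {set {set V}}) (alpha : {set V} -> {set R}) :
    Prop :=
  forall e, e \in E -> is_ideal (alpha e).

Definition is_spline (E : {set {set V}}) (alpha : {set V} -> {set R})
    (f : {ffun V -> R}) : bool :=
  [forall u, forall v, adj E u v ==> (f u - f v \in alpha [set u; v])].

Definition zero_adj (E : {set {set V}}) (alpha : {set V} -> {set R}) : rel V :=
  fun u v => adj E u v && (alpha [set u; v] == [set 0]).

Definition zero_components (E : {set {set V}}) (alpha : {set V} -> {set R}) :
    {set {set V}} :=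
  equivalence_partition (connect (zero_adj E alpha)) [set: V].

Definition indicator (C : {set V}) : {ffun V -> R} :=
  [ffun v => (v \in C)%:R].

Definition component_splines (E : {set {set V}})
    (alpha : {set V} -> {set R}) : {set {ffun V -> R}} :=
  [set f | is_spline E alpha f
           & [exists C in zero_components E alpha, f == indicator C]].

End Splines.

(* Reduction Z/m -> Z/d; it is a ring morphism when 1 < d and d divides m. *)
Definition reduce (m d : nat) (x : 'Z_m) : 'Z_d := (x : nat)%:R.

Definition reduce_spline (V : finType) (m d : nat) (f : {ffun V -> 'Z_m}) :
    {ffun V -> 'Z_d} :=
  [ffun v => reduce d (f v)].

Definition reduce_label (V : finType) (m d : nat)
    (alpha : {set V} -> {set 'Z_m}) : {set V} -> {set 'Z_d} :=
  fun e => [set reduce d x | x in alpha e].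

Definition B_prime (V : finType) (E : {set {set V}}) (m : nat)
    (alpha : {set V} -> {set 'Z_m}) (d : nat) : {set {ffun V -> 'Z_d}} :=
  component_splines E (reduce_label d alpha).

Definition is_ordering (T : finType) (A : {set T}) (o : seq T) : Prop :=
  uniq o /\ o =i A.

(* ord r lists the chosen ordering of B_{p_r}.  Past the end of that list, nth
   returns the zero spline, and max_r (size (ord r)) is the number of steps
   needed to use up all the lists.  Positions are numbered from 0. *)
Definition is_B_m (V : finType) (E : {set {set V}}) (s : nat) (p : 'I_s -> nat)
    (m : nat) (alpha : {set V} -> {set 'Z_m})
    (ord : forall r : 'I_s, seq {ffun V -> 'Z_(p r)})
    (b : seq {ffun V -> 'Z_m}) : Prop :=
  size b = (\max_(r < s) size (ord r))%N /\
  forall k, (k < size b)%N ->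
    is_spline E alpha (nth 0 b k) /\
    forall r : 'I_s, reduce_spline (p r) (nth 0 b k) = nth 0 (ord r) k.

(* The facts below show that the data described by is_B_m always exist and are
   unique, and that component_splines over Z/p has one element for each
   zero-connected component. *)

Lemma indicator_inj (V : finType) (R : finComNzRingType) :
  injective (@indicator V R).
Proof.
move=> C D /ffunP eqCD; apply/setP => v; move: (eqCD v); rewrite !ffunE.
by case: (v \in C); case: (v \in D) => //= /eqP; rewrite ?oner_eq0 // eq_sym oner_eq0.
Qed.

Section Reduction.

Variables (m d : nat).
Hypotheses (m_gt1 : (1 < m)%N) (d_gt1 : (1 < d)%N) (d_dvd_m : (d %| m)%N).

Lemma reduce_nat k : reduce d (k%:R : 'Z_m) = k%:R.
Proof. by apply: val_inj; rewrite /= !val_Zp_nat // modn_dvdm. Qed.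

Lemma reduce0 : reduce d (0 : 'Z_m) = 0.
Proof. exact: (reduce_nat 0). Qed.

Lemma reduceD (x y : 'Z_m) : reduce d (x + y) = reduce d x + reduce d y.
Proof.
by rewrite -[x in LHS]natr_Zp -[y in LHS]natr_Zp -natrD reduce_nat natrD.
Qed.

Lemma reduceM (x y : 'Z_m) : reduce d (x * y) = reduce d x * reduce d y.
Proof.
by rewrite -[x in LHS]natr_Zp -[y in LHS]natr_Zp -natrM reduce_nat natrM.
Qed.

Lemma reduceB (x y : 'Z_m) : reduce d (x - y) = reduce d x - reduce d y.
Proof. by apply/(canRL (addrK _)); rewrite -reduceD subrK. Qed.

Lemma reduce_sum (I : finType) (F : I -> 'Z_m) :
  reduce d (\sum_i F i) = \sum_i reduce d (F i).
Proof. exact: (big_morph _ reduceD reduce0). Qed.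

Lemma reduce_eq0 (x : 'Z_m) : (reduce d x == 0) = (d %| x)%N.
Proof. by rewrite -val_eqE /= val_Zp_nat. Qed.

Lemma reduce_ideal (I : {set 'Z_m}) :
  is_ideal I -> is_ideal [set reduce d x | x in I].
Proof.
case=> -[I0 IB] IM; split; first split.
- by apply/imsetP; exists 0; rewrite ?reduce0.
- move=> _ _ /imsetP[x Ix ->] /imsetP[y Iy ->].
  by rewrite -reduceB imset_f // IB.
move=> a _ /imsetP[x Ix ->]; apply/imsetP; exists ((a : nat)%:R * x).
  exact: IM.
by rewrite reduceM reduce_nat natr_Zp.
Qed.

End Reduction.

Lemma zero_components_edge (V : finType) (R : finComNzRingType)
    (E : {set {set V}}) (alpha : {set V} -> {set R}) C u v :
  C \in zero_components E alpha -> adj E u v -> alpha [set u; v] = [set 0] ->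
  (u \in C) = (v \in C).
Proof.
have sym : connect_sym (zero_adj E alpha).
  apply: sym_connect_sym => a b.
  by rewrite /zero_adj /adj setUC.
move=> /imsetP[w _ ->] uv luv; rewrite !inE /=; apply: same_connect_r => //.
by rewrite connect1 // /zero_adj uv luv eqxx.
Qed.

Lemma B_primeE (V : finType) (E : {set {set V}}) (m d : nat)
    (alpha : {set V} -> {set 'Z_m}) :
  (1 < m)%N -> prime d -> (d %| m)%N -> edge_labeling E alpha ->
  B_prime E alpha d
    = @indicator V _ @: zero_components E (reduce_label d alpha).
Proof.
move=> m_gt1 d_prime d_dvd alpha_ideal; have d_gt1 := prime_gt1 d_prime.
apply/setP => f; rewrite inE; apply/andP/imsetP => [[_]|[C CZ ->]].
  by case/existsP=> C /andP[CZ /eqP->]; exists C.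
split; last by apply/existsP; exists C; rewrite CZ eqxx.
apply/forallP => u; apply/forallP => v; apply/implyP => uv.
set I := reduce_label d alpha [set u; v].
have [[I0 IB] IM] : is_ideal I by apply: reduce_ideal => //; apply: alpha_ideal.
have [I_zero | /eqP I_nz] := eqVneq I [set 0].
  by rewrite !ffunE (zero_components_edge CZ uv I_zero) subrr.
have [x Ix x_nz] : exists2 x, x \in I & x != 0.
  apply/exists_inP; apply: (contra_notT _ I_nz) => /exists_inPn allI.
  apply/setP => y; rewrite inE; apply/idP/eqP => [Iy|->//].
  by apply/eqP; move/negbNE: (allI y Iy).
suff unit_x : x \is a GRing.unit by rewrite -[_ - _](mulrVK unit_x) IM.
rewrite -[x]natr_Zp unitZpE // prime_coprime //.
have xd : (x < d)%N by rewrite -{2}(Zp_cast d_gt1).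
apply: contra x_nz => dx; rewrite -val_eqE /=; rewrite eqn0Ngt; apply: contraTN xd => x_gt0.
by rewrite -leqNgt dvdn_leq.
Qed.

Section ChineseRemainder.

Variables (s : nat) (p : 'I_s -> nat) (m : nat).
Hypotheses (s_gt0 : (0 < s)%N) (p_prime : forall r, prime (p r)).
Hypotheses (p_inj : injective p) (m_def : m = (\prod_(r < s) p r)%N).

Lemma prime_dvd_modulus r : (p r %| m)%N.
Proof. by rewrite m_def (bigD1 r) //= dvdn_mulr. Qed.

Lemma modulus_gt1 : (1 < m)%N.
Proof.
pose r0 : 'I_s := Ordinal s_gt0.
have m_gt0 : (0 < m)%N.
  by rewrite m_def prodn_gt0 // => r; apply: prime_gt0.
exact: leq_trans (prime_gt1 (p_prime r0)) (dvdn_leq m_gt0 (prime_dvd_modulus r0)).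
Qed.

Let m_gt1 := modulus_gt1.
Let p_gt1 r := prime_gt1 (p_prime r).
Let p_dvd := prime_dvd_modulus.
#[local] Hint Resolve m_gt1 p_gt1 p_dvd : core.

Lemma coprime_prod_primes r (t : seq 'I_s) :
  r \notin t -> coprime (p r) (\prod_(k <- t) p k)%N.
Proof.
elim: t => [|k t IH]; first by rewrite big_nil coprimen1.
rewrite inE negb_or big_cons coprimeMr => /andP[rk /IH->]; rewrite andbT.
rewrite prime_coprime // dvdn_prime2 //.
by apply: contra rk => /eqP/p_inj->.
Qed.

Lemma modulus_dvd x : (forall r, p r %| x)%N -> (m %| x)%N.
Proof.
move=> px; rewrite m_def; have := index_enum_uniq 'I_s.
elim: (index_enum _) => [|k t IH]; first by rewrite big_nil dvd1n.
rewrite big_cons /= => /andP[kt ut].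
by rewrite Gauss_dvd ?coprime_prod_primes // px IH.
Qed.

Lemma reduce_inj (x y : 'Z_m) :
  (forall r, reduce (p r) x = reduce (p r) y) -> x = y.
Proof.
move=> eqxy; apply/eqP; rewrite -subr_eq0; set z := x - y.
have /modulus_dvd mz : forall r, (p r %| z)%N.
  by move=> r; rewrite -reduce_eq0 // reduceB // eqxy subrr.
by rewrite -[z]natr_Zp -val_eqE /= val_Zp_nat.
Qed.

Lemma idempotent_exists r :
  exists e : nat, forall k, e%:R = (k == r)%:R :> 'Z_(p k).
Proof.
pose q := (\prod_(k <- rem r (index_enum 'I_s)) p k)%N.
have co : coprime (p r) q.
  by apply: coprime_prod_primes; rewrite mem_rem_uniqF ?index_enum_uniq.
exists (chinese (p r) q 1 0) => k; apply: val_inj; rewrite /= !val_Zp_nat //.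
have [-> | kr] := eqVneq k r; first exact: chinese_modl.
have kq : (p k %| q)%N.
  have kin : k \in rem r (index_enum 'I_s).
    by rewrite mem_rem_uniq ?index_enum_uniq // inE kr mem_index_enum.
  by rewrite /q (big_rem k kin) dvdn_mulr.
by rewrite -(modn_dvdm _ kq) chinese_modr // mod0n.
Qed.

Variables (V : finType) (E : {set {set V}}) (alpha : {set V} -> {set 'Z_m}).
Hypothesis alpha_ideal : edge_labeling E alpha.

Lemma spline_lift (g : forall r : 'I_s, {ffun V -> 'Z_(p r)}) :
  (forall r, is_spline E (reduce_label (p r) alpha) (g r)) ->
  exists2 f : {ffun V -> 'Z_m},
    is_spline E alpha f & forall r, reduce_spline (p r) f = g r.
Proof.
move=> g_spline; have [e eE] := fin_all_exists idempotent_exists.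
pose f := [ffun v => \sum_r (e r)%:R * (g r v : nat)%:R : 'Z_m].
have reduce_f r v : reduce (p r) (f v) = g r v.
  rewrite ffunE reduce_sum // (bigD1 r) //= reduceM // !reduce_nat //.
  rewrite eE eqxx mul1r natr_Zp big1 ?addr0 // => k kr.
  by rewrite reduceM // !reduce_nat // eE eq_sym (negPf kr) mul0r.
exists f => [|r]; last by apply/ffunP => v; rewrite ffunE.
apply/forallP => u; apply/forallP => v; apply/implyP => uv.
have [[I0 IB] IM] := alpha_ideal uv.
have ID x y : x \in alpha [set u; v] -> y \in alpha [set u; v] ->
    x + y \in alpha [set u; v].
  by move=> Ix Iy; rewrite -[y]opprK IB // -sub0r IB.
have decomp : f u - f v = \sum_r (e r)%:R * (f u - f v).
  apply: reduce_inj => r; rewrite reduce_sum // (bigD1 r) //= reduceM //.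
  rewrite reduce_nat // eE eqxx mul1r big1 ?addr0 // => k kr.
  by rewrite reduceM // reduce_nat // eE eq_sym (negPf kr) mul0r.
rewrite decomp; apply: (big_ind (fun x => x \in alpha [set u; v])) => // r _.
have /forallP/(_ u)/forallP/(_ v)/implyP/(_ uv)/imsetP[y Iy gy] := g_spline r.
suff -> : (e r)%:R * (f u - f v) = (e r)%:R * y by apply: IM.
apply: reduce_inj => k; rewrite !reduceM // !reduce_nat // eE.
have [-> | _] := eqVneq k r; last by rewrite !mul0r.
by rewrite !mul1r reduceB // !reduce_f.
Qed.

Lemma B_m_exists (ord : forall r : 'I_s, seq {ffun V -> 'Z_(p r)}) :
  (forall r, is_ordering (B_prime E alpha (p r)) (ord r)) ->
  exists b, is_B_m E alpha ord b.
Proof.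
move=> ordP; set N := (\max_(r < s) size (ord r))%N.
have lift (k : 'I_N) : exists f : {ffun V -> 'Z_m}, is_spline E alpha f /\
    forall r, reduce_spline (p r) f = nth 0 (ord r) k.
  have [r|f f_spline f_red] := @spline_lift (fun r => nth 0 (ord r) k); last by exists f.
  have [kr|kr] := ltnP k (size (ord r)).
    by have := mem_nth 0 kr; rewrite (ordP r).2 inE => /andP[].
  rewrite nth_default //; apply/forallP => u; apply/forallP => v.
  apply/implyP => uv; rewrite !ffunE subr0.
  have [] // := @reduce_ideal _ _ m_gt1 (p_gt1 r) (p_dvd r) _ (alpha_ideal uv).
  by case.
have [F FP] := fin_all_exists lift.
exists (map F (enum 'I_N)); split; first by rewrite size_map size_enum_ord.
move=> k; rewrite size_map size_enum_ord => kN.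
rewrite (nth_map (Ordinal kN)) ?size_enum_ord //.
have := FP (nth (Ordinal kN) (enum 'I_N) k).
by rewrite nth_enum_ord.
Qed.

Lemma B_m_unique (ord : forall r : 'I_s, seq {ffun V -> 'Z_(p r)}) b c :
  is_B_m E alpha ord b -> is_B_m E alpha ord c -> b = c.
Proof.
move=> [b_size bP] [c_size cP]; have eq_size : size b = size c by rewrite b_size.
apply: (@eq_from_nth _ 0) => // k kb; apply/ffunP => v; apply: reduce_inj => r.
have [_ /(_ r)/ffunP/(_ v)] := bP k kb.
have [|_ /(_ r)/ffunP/(_ v)] := cP k; first by rewrite -eq_size.
by rewrite !ffunE => -> ->.
Qed.

End ChineseRemainder.

(* Main.v *)
(* Modulo each prime, the i-th and j-th splines reduce to indicators of
   zero-connected components or to zero; indicators are idempotent, and those of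
   distinct components are orthogonal because the components partition V.  The
   Chinese remainder theorem lifts both relations to Z/m. *)
Require Import Defs.
From mathcomp Require Import all_boot all_order all_algebra.
Import GRing.Theory.
Local Open Scope ring_scope.

(** [zero_adj] is symmetric because an edge is an unordered pair, so connectivity along it is an
    equivalence relation and its classes are disjoint. *)
Lemma zero_components_trivIset (V : finType) (R : finComNzRingType)
    (E : {set {set V}}) (alpha : {set V} -> {set R}) :
  trivIset (zero_components E alpha).
Proof.
have sym : connect_sym (zero_adj E alpha).
  by apply: sym_connect_sym => u v; rewrite /zero_adj /adj setUC.
have eqv : {in [set: V] & &, equivalence_rel (connect (zero_adj E alpha))}.
  move=> u v w _ _ _; split=> [|uv]; first exact: connect0.
  by rewrite (same_connect sym uv).
by case/and3P: (equivalence_partitionP eqv).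
Qed.

Lemma component_splines_mul (V : finType) (R : finComNzRingType)
    (E : {set {set V}}) (alpha : {set V} -> {set R}) (f g : {ffun V -> R}) :
  f \in component_splines E alpha -> g \in component_splines E alpha ->
  f * g = if f == g then f else 0.
Proof.
rewrite !inE => /andP[_ /exists_inP[C CZ /eqP->]].
move=> /andP[_ /exists_inP[D DZ /eqP->]].
(* Injectivity of [indicator] turns the comparison of splines into one of components. *)
rewrite (inj_eq (@indicator_inj V R)); have [<-|CD] := eqVneq C D.
  by apply/ffunP => v; rewrite !ffunE -natrM mulnb andbb.
have disj := trivIsetP (zero_components_trivIset _ _ E alpha) _ _ CZ DZ CD.
apply/ffunP => v; rewrite !ffunE -natrM mulnb.
by case: (boolP (v \in C)) => //= vC; rewrite (disjointFr disj vC).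
Qed.

(** No bound is put on [i] and [j]: a position valid in [b] may lie past the end of a shorter list
    [ord r], where the default is the zero spline. *)
Lemma nth_component_splines_mul (V : finType) (R : finComNzRingType)
    (E : {set {set V}}) (alpha : {set V} -> {set R}) (o : seq {ffun V -> R})
    (i j : nat) :
  is_ordering (component_splines E alpha) o ->
  nth 0 o i * nth 0 o j = if i == j then nth 0 o i else 0.
Proof.
case=> o_uniq oE; have [io|io] := ltnP i (size o); last first.
  by rewrite (nth_default _ io) mul0r if_same.
have [jo|jo] := ltnP j (size o); last first.
  by rewrite (nth_default _ jo) mulr0 (ltn_eqF (leq_trans io jo)).
(* Since [o] has no repetition, equal entries mean equal positions. *)
by rewrite (component_splines_mul _ _ E alpha) -?oE ?mem_nth // nth_uniq.
Qed.

Theorem theorem5p2 (s : nat) (p : 'I_s -> nat) (m : nat)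
    (s_gt0 : (0 < s)%N)
    (p_prime : forall r, prime (p r))
    (p_inj : injective p)
    (m_def : m = (\prod_(r < s) p r)%N)
    (n : nat) (E : {set {set 'I_n}})
    (E_simple : simple_graph E)
    (E_conn : connected_graph E)
    (alpha : {set 'I_n} -> {set 'Z_m})
    (alpha_ideal : edge_labeling E alpha)
    (ord : forall r : 'I_s, seq {ffun 'I_n -> 'Z_(p r)})
    (ord_B : forall r : 'I_s, is_ordering (B_prime E alpha (p r)) (ord r))
    (b : seq {ffun 'I_n -> 'Z_m})
    (b_def : is_B_m E alpha ord b)
    (i j : nat) (i_lt : (i < size b)%N) (j_lt : (j < size b)%N) :
  nth 0 b i * nth 0 b j = if i == j then nth 0 b i else 0.
Proof.
have m_gt1 := modulus_gt1 s_gt0 p_prime m_def.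
have p_gt1 r : (1 < p r)%N := prime_gt1 (p_prime r).
have p_dvd r : (p r %| m)%N := prime_dvd_modulus m_def r.
case: b_def => _ bP.
have red k v r : (k < size b)%N -> reduce (p r) (nth 0 b k v) = nth 0 (ord r) k v.
  by move=> /bP[_ /(_ r)/ffunP/(_ v)]; rewrite ffunE.
(* An element of ['Z_m] is determined by its residues modulo all the [p r]. *)
apply/ffunP => v; apply: (reduce_inj s_gt0 p_prime p_inj m_def) => r.
rewrite ffunE reduceM // !red //.
have /ffunP/(_ v) := nth_component_splines_mul _ _ _ _ _ i j (ord_B r); rewrite ffunE => ->.
by case: (i == j); rewrite ?red // !ffunE reduce0.
Qed.
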